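(* Let $L$ be a lattice and $\Gamma$ a directed lattice of rings over $L$, with transition homomorphisms $f_{j,i}:\Gamma_i\to\Gamma_j$, such that for all $i\in L$ and all $x\in\Gamma_i$ the set $$J_x=\{j\in L\mid j\leq i,\ f_{j,i}(x)\in\Gamma_j^{\times}\}$$ has a unique maximal element. Then there exists a common meadow $M=\bigsqcup_{i\in L}\Gamma_i$ such that the lattice $0\cdot M$ is isomorphic to $L$.
   Context: A common meadow is a set $M$ with constants $0,1,\mathbf{a}$, binary operations $+,\cdot$ and unary operations $-$ and $(\cdot)^{-1}$ such that for all $x,y,z\in M$: $(x+y)+z=x+(y+z)$; $x+y=y+x$; $x+0=x$; $x+(-x)=0\cdot x$; $(x\cdot y)\cdot z=x\cdot(y\cdot z)$; $x\cdot y=y\cdot x$; $1\cdot x=x$; $x\cdot(y+z)=x\cdot y+x\cdot z$; $-(-x)=x$; $x\cdot x^{-1}=1+0\cdot x^{-1}$; $(x\cdot y)^{-1}=x^{-1}\cdot y^{-1}$; $(1+0\cdot x)^{-1}=1+0\cdot x$; $0^{-1}=\mathbf{a}$; $x+\mathbf{a}=\mathbf{a}$. The set $0\cdot M=\{0\cdot x\mid x\in M\}$ is partially ordered by $z\leq z'$ iff $z\cdot z'=z$. A directed lattice of rings $\Gamma$ over a countable lattice $L$ (with least element $\min(L)$) consists of a family of commutative rings $\Gamma_i$, $i\in L$, such that $\Gamma_i$ is a unital commutative ring (commutative, with identity different from zero) for all $i\in L\setminus\{\min(L)\}$ and $\Gamma_{\min(L)}$ is the zero ring, together with a family of (identity-preserving)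 ring homomorphisms $f_{j,i}:\Gamma_i\to\Gamma_j$ whenever $i>j$, such that $f_{k,j}\circ f_{j,i}=f_{k,i}$ for all $i>j>k$. By convention $f_{i,i}$ is the identity map of $\Gamma_i$. $R^{\times}$ denotes the set of invertible elements of a ring $R$ (in the zero ring its unique element is invertible). ''$M=\bigsqcup_{i\in L}\Gamma_i$'' means that the underlying set of $M$ is the disjoint union of the sets $\Gamma_i$, and that the operations $+,-,\cdot$ of $M$ restrict on each $\Gamma_i$ to its ring operations.
   Formalization: The lattice L is also assumed to have a greatest element (forced, since 0 is the top of 0·M), and every element of J_x is assumed to lie below a maximal element of J_x, so that the unique maximal element is the greatest; without these the claim fails for some infinite L. *)

(* Defs.v *)
From HB Require Import structures.
From mathcomp Require Import all_boot all_order all_algebra.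
From mathcomp Require Import boolp classical_sets functions cardinality.

Set Implicit Arguments.
Unset Strict Implicit.
Unset Printing Implicit Defensive.

Import Order.TTheory GRing.Theory.

Local Open Scope ring_scope.
Local Open Scope classical_set_scope.

Record common_meadow (M : Type) := CommonMeadow {
  cm_zero : M;
  cm_one : M;
  cm_a : M;
  cm_add : M -> M -> M;
  cm_mul : M -> M -> M;
  cm_opp : M -> M;
  cm_inv : M -> M;
  cm_addA : forall x y z, cm_add (cm_add x y) z = cm_add x (cm_add y z);
  cm_addC : forall x y, cm_add x y = cm_add y x;
  cm_addx0 : forall x, cm_add x cm_zero = x;
  cm_addxN : forall x, cm_add x (cm_opp x) = cm_mul cm_zero x;
  cm_mulA : forall x y z, cm_mul (cm_mul x y) z = cm_mul x (cm_mul y z);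
  cm_mulC : forall x y, cm_mul x y = cm_mul y x;
  cm_mul1x : forall x, cm_mul cm_one x = x;
  cm_mulD : forall x y z,
    cm_mul x (cm_add y z) = cm_add (cm_mul x y) (cm_mul x z);
  cm_oppK : forall x, cm_opp (cm_opp x) = x;
  cm_mulxV : forall x,
    cm_mul x (cm_inv x) = cm_add cm_one (cm_mul cm_zero (cm_inv x));
  cm_invM : forall x y, cm_inv (cm_mul x y) = cm_mul (cm_inv x) (cm_inv y);
  cm_inv1D0 : forall x,
    cm_inv (cm_add cm_one (cm_mul cm_zero x)) =
    cm_add cm_one (cm_mul cm_zero x);
  cm_inv0 : cm_inv cm_zero = cm_a;
  cm_addxa : forall x, cm_add x cm_a = cm_a
}.

Definition zero_part (M : Type) (S : common_meadow M) : Type :=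
  {z : M | exists x : M, z = cm_mul S (cm_zero S) x}.

Definition zero_part_le (M : Type) (S : common_meadow M)
    (z z' : zero_part S) : Prop :=
  cm_mul S (sval z) (sval z') = sval z.

Definition order_isomorphic (T U : Type)
    (leT : T -> T -> Prop) (leU : U -> U -> Prop) : Prop :=
  exists phi : T -> U,
    bijective phi /\ forall x y, leT x y <-> leU (phi x) (phi y).

(* The rings are [comPzRingType]s because the one at [\bot] is the zero ring.
   The transition maps are indexed by [j <= i], so that the convention that
   f_{i,i} is the identity becomes a field of the structure. *)
Record directed_lattice_of_rings (d : Order.disp_t) (L : bLatticeType d) :=
  DirectedLatticeOfRings {
  dl_ring :> L -> comPzRingType;
  dl_map : forall i j : L, (j <= i)%O -> {rmorphism dl_ring i -> dl_ring j};
  dl_countable : countable [set: L];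
  dl_nontrivial : forall i : L, i <> \bot%O -> (1 : dl_ring i) <> 0;
  dl_bot : forall x : dl_ring \bot%O, x = 0;
  dl_map_id : forall (i : L) (hii : (i <= i)%O) (x : dl_ring i),
    dl_map hii x = x;
  dl_map_comp : forall (i j k : L)
    (hji : (j <= i)%O) (hkj : (k <= j)%O) (hki : (k <= i)%O) (x : dl_ring i),
    dl_map hkj (dl_map hji x) = dl_map hki x
}.

(* [GRing.unit] is not available here: a [unitRingType] cannot be the zero
   ring. *)
Definition invertible (R : comPzRingType) (x : R) : Prop :=
  exists y : R, x * y = 1.

Definition J (d : Order.disp_t) (L : bLatticeType d)
    (G : directed_lattice_of_rings L) (i : L) (x : G i) : set L :=
  [set j | exists hji : (j <= i)%O, invertible (dl_map G hji x)].

Definition maximal_in (d : Order.disp_t) (L : porderType d)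
    (A : set L) (m : L) : Prop :=
  A m /\ forall j : L, A j -> (m <= j)%O -> j = m.

(* [S] is a structure on the disjoint union itself, not on a copy of it. *)
Definition restricts_to_rings (d : Order.disp_t) (L : bLatticeType d)
    (G : directed_lattice_of_rings L)
    (S : common_meadow {i : L & G i}) : Prop :=
  forall i : L,
    [/\ forall x y : G i,
          cm_add S (existT _ i x) (existT _ i y) = existT _ i (x + y),
        forall x : G i, cm_opp S (existT _ i x) = existT _ i (- x)
      & forall x y : G i,
          cm_mul S (existT _ i x) (existT _ i y) = existT _ i (x * y)].

(* Main.v *)
(* Because units map to units, the hypothesis says that J_x is the principal
   ideal below some g(x).  Restrict both arguments of + and * to the meet of
   their indices, and let the inverse of x be the inverse of its restriction to
   g(x).  The product law for inverses is J_(xy) = J_x /\ J_y, and 0^-1 = a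
   holds because 0 is a unit only in the ring at \bot.  The elements of 0 * M
   are the zeros of the rings, one for each index. *)
Require Import Defs.
From mathcomp Require Import all_boot all_order all_algebra.
From mathcomp Require Import boolp classical_sets functions cardinality.

Set Implicit Arguments.
Unset Strict Implicit.
Unset Printing Implicit Defensive.

Import Order.TTheory GRing.Theory.

Local Open Scope ring_scope.

Section Restriction.
Context {d : Order.disp_t} {L : tbLatticeType d}.
Variable G : directed_lattice_of_rings L.
Implicit Types (i j k : L) (p q r : {i : L & G i}).
Local Notation pt i x := (existT (fun j : L => GRing.ComPzRing.sort (G j)) i x).

(* Junk value 0 when [k] is not below the index of [p]; being total in [k], this
   keeps proofs of [k <= i] out of the terms. *)
Definition res k p : G k :=
  if pselect (k <= tag p)%O is left h then dl_map G h (tagged p) else 0.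

Lemma resE k p (h : (k <= tag p)%O) : res k p = dl_map G h (tagged p).
Proof.
by rewrite /res; case: pselect => // h'; rewrite (bool_irrelevance h h').
Qed.

Lemma res_tag p : res (tag p) p = tagged p.
Proof. by rewrite (resE (lexx _)) dl_map_id. Qed.

Lemma res_Tagged i (x : G i) : res i (pt i x) = x.
Proof. exact: (res_tag (pt i x)). Qed.

Lemma res_res j k p : (j <= k)%O -> (k <= tag p)%O ->
  res j (pt k (res k p)) = res j p.
Proof.
move=> hjk hk; rewrite (@resE j (pt k (res k p)) hjk) /= (resE hk).
by rewrite (dl_map_comp hk hjk (le_trans hjk hk)) -resE.
Qed.

Lemma res_ext p q : tag p = tag q ->
  (forall k, (k <= tag p)%O -> res k p = res k q) -> p = q.
Proof.
case: p => i x; case: q => j y /= eij; case: j / eij y => y /(_ i (lexx i)).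
by rewrite !res_Tagged => ->.
Qed.

Lemma resD k i (x y : G i) : (k <= i)%O ->
  res k (pt i (x + y)) = res k (pt i x) + res k (pt i y).
Proof.
move=> h; rewrite (@resE k (pt i (x + y)) h) (@resE k (pt i x) h).
by rewrite (@resE k (pt i y) h) /= rmorphD.
Qed.

Lemma resM k i (x y : G i) : (k <= i)%O ->
  res k (pt i (x * y)) = res k (pt i x) * res k (pt i y).
Proof.
move=> h; rewrite (@resE k (pt i (x * y)) h) (@resE k (pt i x) h).
by rewrite (@resE k (pt i y) h) /= rmorphM.
Qed.

Lemma resN k i (x : G i) : (k <= i)%O ->
  res k (pt i (- x)) = - res k (pt i x).
Proof.
move=> h; rewrite (@resE k (pt i (- x)) h) (@resE k (pt i x) h).
by rewrite /= rmorphN.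
Qed.

Lemma res0 k i : (k <= i)%O -> res k (pt i (0 : G i)) = 0.
Proof. by move=> h; rewrite (@resE k (pt i 0) h) /= rmorph0. Qed.

Lemma res1 k i : (k <= i)%O -> res k (pt i (1 : G i)) = 1.
Proof. by move=> h; rewrite (@resE k (pt i 1) h) /= rmorph1. Qed.

Definition sum_zero : {i : L & G i} := pt \top%O 0.
Definition sum_one : {i : L & G i} := pt \top%O 1.
Definition sum_abs : {i : L & G i} := pt \bot%O 0.
Definition sum_add p q : {i : L & G i} :=
  let k := (tag p `&` tag q)%O in pt k (res k p + res k q).
Definition sum_mul p q : {i : L & G i} :=
  let k := (tag p `&` tag q)%O in pt k (res k p * res k q).
Definition sum_opp p : {i : L & G i} := pt (tag p) (- tagged p).

Lemma res_add k p q : (k <= tag p)%O -> (k <= tag q)%O ->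
  res k (sum_add p q) = res k p + res k q.
Proof.
move=> hp hq; have hk : (k <= tag p `&` tag q)%O by rewrite lexI hp.
by rewrite resD // !res_res ?leIl ?leIr.
Qed.

Lemma res_mul k p q : (k <= tag p)%O -> (k <= tag q)%O ->
  res k (sum_mul p q) = res k p * res k q.
Proof.
move=> hp hq; have hk : (k <= tag p `&` tag q)%O by rewrite lexI hp.
by rewrite resM // !res_res ?leIl ?leIr.
Qed.

Lemma res_opp k p : (k <= tag p)%O -> res k (sum_opp p) = - res k p.
Proof. by move=> h; rewrite resN // -(res_tag p) res_res. Qed.

Lemma res_zero k : res k sum_zero = 0.
Proof. by rewrite res0 ?lex1. Qed.

Lemma res_one k : res k sum_one = 1.
Proof. by rewrite res1 ?lex1. Qed.

Lemma sum_addA p q r : sum_add (sum_add p q) r = sum_add p (sum_add q r).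
Proof.
apply: res_ext => [|k] /=; first by rewrite meetA.
rewrite !lexI => /andP[/andP[hp hq] hr].
by rewrite !res_add ?addrA //= lexI ?hp ?hq.
Qed.

Lemma sum_addC p q : sum_add p q = sum_add q p.
Proof.
apply: res_ext => [|k] /=; first by rewrite meetC.
by rewrite !lexI => /andP[hp hq]; rewrite !res_add // addrC.
Qed.

Lemma sum_addx0 p : sum_add p sum_zero = p.
Proof.
apply: res_ext => [|k] /=; rewrite meetx1 // => hp.
by rewrite res_add ?lex1 // res_zero addr0.
Qed.

Lemma sum_addxN p : sum_add p (sum_opp p) = sum_mul sum_zero p.
Proof.
apply: res_ext => [|k] /=; first by rewrite meetxx meet1x.
rewrite meetxx => hp.
by rewrite res_add // res_mul ?lex1 // res_opp // subrr res_zero mul0r.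
Qed.

Lemma sum_mulA p q r : sum_mul (sum_mul p q) r = sum_mul p (sum_mul q r).
Proof.
apply: res_ext => [|k] /=; first by rewrite meetA.
rewrite !lexI => /andP[/andP[hp hq] hr].
by rewrite !res_mul ?mulrA //= lexI ?hp ?hq.
Qed.

Lemma sum_mulC p q : sum_mul p q = sum_mul q p.
Proof.
apply: res_ext => [|k] /=; first by rewrite meetC.
by rewrite !lexI => /andP[hp hq]; rewrite !res_mul // mulrC.
Qed.

Lemma sum_mul1x p : sum_mul sum_one p = p.
Proof.
apply: res_ext => [|k] /=; rewrite meet1x // => hp.
by rewrite res_mul ?lex1 // res_one mul1r.
Qed.

Lemma sum_mulD p q r :
  sum_mul p (sum_add q r) = sum_add (sum_mul p q) (sum_mul p r).
Proof.
apply: res_ext => [|k] /=; first by rewrite meetACA meetxx.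
rewrite !lexI => /and3P[hp hq hr].
rewrite res_mul ?res_add ?res_mul //= ?lexI ?hp ?hq ?hr //.
by rewrite mulrDr.
Qed.

Lemma sum_oppK p : sum_opp (sum_opp p) = p.
Proof. by case: p => i x; rewrite /sum_opp /= opprK. Qed.

Lemma sum_mul0 p : sum_mul sum_zero p = pt (tag p) 0.
Proof.
apply: res_ext => [|k] /=; rewrite meet1x // => hp.
by rewrite res_mul ?lex1 // res_zero mul0r res0.
Qed.

Lemma sum_add1 i : sum_add sum_one (pt i 0) = pt i 1.
Proof.
apply: res_ext => [|k] /=; rewrite meet1x // => hi.
by rewrite res_add ?lex1 // res_one res0 // addr0 res1.
Qed.

Lemma sum_addxa p : sum_add p sum_abs = sum_abs.
Proof.
apply: res_ext => [|k] /=; first by rewrite meetx0.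
rewrite meetx0 lex0 => /eqP ->.
by rewrite (dl_bot (res _ _)) [RHS]dl_bot.
Qed.

Definition is_inverse p q :=
  [/\ (tag q <= tag p)%O, res (tag q) p * tagged q = 1 &
      forall k, (k <= tag p)%O -> invertible (res k p) -> (k <= tag q)%O].

Lemma is_inverse_res k p q : is_inverse p q -> (k <= tag q)%O ->
  res k p * res k q = 1.
Proof.
case: q => i x [/= hi xV _] hk.
by rewrite -(res_res hk hi) -resM // xV res1.
Qed.

Lemma is_inverse_inj p q r : is_inverse p q -> is_inverse p r -> q = r.
Proof.
case: q => i x; case: r => j y [/= hi xV hmax] [/= hj yV hmay].
have eij : i = j.
  by apply/le_anti/andP; split; [apply: hmay|apply: hmax] => //;
    [exists x | exists y].
case: j / eij y hj yV hmay => y _ yV _.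
by congr existT; rewrite -[x]mulr1 -yV mulrA [x * _]mulrC xV mul1r.
Qed.

Lemma is_inverse_mul p p' q q' : is_inverse p p' -> is_inverse q q' ->
  is_inverse (sum_mul p q) (sum_mul p' q').
Proof.
move=> pV qV; have [[hp _ maxp] [hq _ maxq]] := (pV, qV).
have tp : (tag p' `&` tag q' <= tag p)%O by rewrite leIxl.
have tq : (tag p' `&` tag q' <= tag q)%O by rewrite leIxr.
split=> [||k] /=; first by rewrite leI2.
  rewrite res_mul // mulrACA (is_inverse_res pV) ?leIl //.
  by rewrite (is_inverse_res qV) ?leIr // mulr1.
rewrite !lexI => /andP[kp kq]; rewrite res_mul // => -[y xy1].
apply/andP; split; [apply: maxp|apply: maxq] => //.
  by exists (res k q * y); rewrite mulrA.
by exists (res k p * y); rewrite mulrCA mulrA.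
Qed.

Lemma is_inverse_one i : is_inverse (pt i 1) (pt i 1).
Proof. by split=> //=; rewrite res_Tagged mulr1. Qed.

Lemma is_inverse_zero : is_inverse sum_zero sum_abs.
Proof.
split=> [||k _] /=; first exact: le0x.
  by rewrite [LHS]dl_bot [RHS]dl_bot.
rewrite res_zero => -[y]; rewrite mul0r => /esym one0.
rewrite lex0; apply/eqP; apply: contrapT.
by move=> /(@dl_nontrivial _ _ G) /(_ one0).
Qed.

Lemma is_inverse_mulV p q : is_inverse p q ->
  sum_mul p q = sum_add sum_one (sum_mul sum_zero q).
Proof.
rewrite sum_mul0 sum_add1 => qV; have [hq _ _] := qV.
apply: res_ext => [|k] /=; rewrite (meet_r hq) // => hk.
by rewrite res_mul ?(le_trans hk) // (is_inverse_res qV hk) res1.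
Qed.

Lemma greatest_J_inverse p :
  (exists2 m, J (tagged p) m & forall j, J (tagged p) j -> (j <= m)%O) ->
  exists q, is_inverse p q.
Proof.
move=> [m [hm [y xy1]] hmax]; exists (pt m y); split=> //=.
  by rewrite (resE hm).
by move=> k hk kV; apply: hmax; exists hk; rewrite -resE.
Qed.

Section Meadow.
Variables (inv : {i : L & G i} -> {i : L & G i}).
Hypothesis invP : forall p, is_inverse p (inv p).

Lemma sum_invM p q : inv (sum_mul p q) = sum_mul (inv p) (inv q).
Proof. exact: is_inverse_inj (invP _) (is_inverse_mul (invP p) (invP q)). Qed.

Lemma sum_inv1D0 p : inv (sum_add sum_one (sum_mul sum_zero p)) =
  sum_add sum_one (sum_mul sum_zero p).
Proof.
rewrite sum_mul0 sum_add1.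
exact: is_inverse_inj (invP _) (is_inverse_one _).
Qed.

Lemma sum_inv0 : inv sum_zero = sum_abs.
Proof. exact: is_inverse_inj (invP _) is_inverse_zero. Qed.

Definition sum_meadow : common_meadow {i : L & G i} :=
  CommonMeadow sum_addA sum_addC sum_addx0 sum_addxN sum_mulA sum_mulC
    sum_mul1x sum_mulD sum_oppK (fun p => is_inverse_mulV (invP p))
    sum_invM sum_inv1D0 sum_inv0 sum_addxa.

Lemma sum_meadow_restricts : restricts_to_rings sum_meadow.
Proof.
move=> i; split=> [x y|x|x y] //=; apply: res_ext => [|k] /=.
- by rewrite meetxx.
- by rewrite meetxx => hk; rewrite res_add // resD.
- by rewrite meetxx.
- by rewrite meetxx => hk; rewrite res_mul // resM.
Qed.

Lemma sum_meadow_zero_part :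
  order_isomorphic (@zero_part_le _ sum_meadow) (fun i j : L => (i <= j)%O).
Proof.
have zeroP (z : zero_part sum_meadow) : sval z = pt (tag (sval z)) 0.
  by case: z => _ /= [p ->]; rewrite sum_mul0.
have zero_in i : exists p, pt i 0 = cm_mul sum_meadow sum_zero p.
  by exists (pt i 0); rewrite /= sum_mul0.
exists (fun z => tag (sval z)); split.
  exists (fun i => exist _ (pt i 0) (zero_in i)) => [z|//].
  by apply: eq_sig_hprop => [*|]; [exact: Prop_irrelevance | rewrite /= -zeroP].
move=> z z'; rewrite /zero_part_le /= (zeroP z) (zeroP z') /=.
split=> [/(congr1 tag) /= /meet_idPl //|hzz'].
apply: res_ext => [|k] /=; rewrite (meet_l hzz') // => hk.
by rewrite res_mul ?(le_trans hk) // !res0 ?mul0r // (le_trans hk).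
Qed.

End Meadow.
End Restriction.

Theorem theorem3p3 (d : Order.disp_t) (L : tbLatticeType d)
    (G : directed_lattice_of_rings L)
    (hJ : forall (i : L) (x : G i), exists! m : L, maximal_in (J x) m)
    (hJle : forall (i : L) (x : G i) (j : L), J x j ->
      exists m : L, maximal_in (J x) m /\ (j <= m)%O) :
  exists M : common_meadow {i : L & G i},
    restricts_to_rings M /\
    order_isomorphic (@zero_part_le _ M) (fun i j : L => (i <= j)%O).
Proof.
have has_inverse (p : {i : L & G i}) : exists q, is_inverse p q.
  apply: greatest_J_inverse.
  have [m [[Jm _] uniq_m]] := hJ _ (tagged p).
  by exists m => // j /hJle[m' [/uniq_m <-]].
have [inv invP] := choice has_inverse.
exists (sum_meadow invP); split.
  exact: sum_meadow_restricts.
exact: sum_meadow_zero_part.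
Qed.
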